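(* Let $G$ be a locally compact group with $\kappa(G)=1$ (i.e. $G$ is compact). Then $\mathrm{TLIM}_0(G)=\mathrm{TLIM}(G)=\{\mu_G\}$.
   Context: For $S\subset G$, $\kappa(S)$ is the smallest cardinality of a collection of compact subsets of $G$ whose union contains $S$. $|E|$ denotes the left Haar measure of $E\subset G$. $\mathcal L_\infty(G)$ is the usual space with respect to Haar measure, identified with the dual of $\mathcal L_1(G)$. The set of means is $\mathcal M(G)=\{\mu\in\mathcal L_\infty^*(G): \|\mu\|=1,\ \mu\ge 0\}$. Each $f\in\mathcal L_1(G)$ is regarded as an element of $\mathcal L_\infty^*(G)$ via $\phi\mapsto\int_G f\phi$; $\mathcal M_1(G)=\{f\in\mathcal L_1(G):\|f\|_1=1,\ f\ge0\}$. Write $l_x\phi(y)=\phi(x^{-1}y)$ and, for $f\in\mathcal M_1(G)$, $\phi\in\mathcal L_\infty(G)$, $f*\phi=\int_G f(x)\,l_x\phi\,dx$. The topological left-invariant means are $\mathrm{TLIM}(G)=\{\mu\in\mathcal M(G): \mu(\phi)=\mu(f*\phi)\ \text{for all } f\in\mathcal M_1(G),\ \phi\in\mathcal L_\infty(G)\}$. For a compact set $A\subset G$ of positive measure, $\mu_A=\chi_A/|A|$. For $K\subset G$ and $\epsilon>0$, $\mathscr C^+(K,\epsilon)$ is the set of compact $A\subset G$ with $|A|>0$ and $|xA\triangle A|/|A|<\epsilon$ for all $x\in K$. For a mean $\mu$ write $\mu(E)=\mu(\chi_E)$. For a finite measurable partition $\mathcal P$ of $G$ and $\epsilon\in(0,1)$,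 $\mathcal N(\mu,\mathcal P,\epsilon)=\{\nu\in\mathcal M(G): |\mu(E)-\nu(E)|<\epsilon\ \text{for all } E\in\mathcal P\}$. Then $\mathrm{TLIM}_0(G)$ is the set of $\mu\in\mathrm{TLIM}(G)$ such that for every finite measurable partition $\mathcal P$ of $G$, every compact $K\subset G$ and every $\epsilon\in(0,1)$ there is $A\in\mathscr C^+(K,\epsilon)$ with $\mu_A\in\mathcal N(\mu,\mathcal P,\epsilon)$. *)

(* Defs.v *)
From HB Require Import structures.
From mathcomp Require Import all_boot all_order all_algebra.
From mathcomp Require Import all_classical all_reals all_analysis.
From mathcomp Require Import measurable_realfun ess_sup_inf.

Set Implicit Arguments.
Unset Strict Implicit.
Unset Printing Implicit Defensive.

Import Order.TTheory GRing.Theory Num.Theory.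
Import numFieldNormedType.Exports.

Local Open Scope classical_set_scope.
Local Open Scope card_scope.
Local Open Scope ring_scope.

HB.mixin Record isTopologicalGroup G of Topological G & Group G := {
  mulg_continuous : continuous (fun xy : G * G => (xy.1 * xy.2)%g) ;
  invg_continuous : continuous (fun x : G => (x^-1)%g)
}.

#[short(type="topologicalGroupType")]
HB.structure Definition TopologicalGroup :=
  {G of Topological G & Group G & isTopologicalGroup G}.

HB.mixin Record hasBorelSigmaAlgebra d G of Topological G & Measurable d G := {
  measurable_borel : @measurable d G = <<s @open G >>
}.

#[short(type="borelGroupType")]
HB.structure Definition BorelGroup d :=
  {G of TopologicalGroup G & Measurable d G & hasBorelSigmaAlgebra d G}.

Definition compact_cover (G : topologicalType) (S : set G) (F : set (set G)) :=
  (forall K, F K -> compact K) /\ S `<=` \bigcup_(K in F) K.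

(* kappa(S) = |C|: the cardinal kappa(S) is represented by a set C that has it
   as cardinality. *)
Definition kappa_is (G : topologicalType) (S : set G) I (C : set I) :=
  (exists2 F, compact_cover S F & F #= C) /\
  (forall F, compact_cover S F -> C #<= F).

Section topological_left_invariant_means.
Context {d : measure_display} {G : borelGroupType d} {R : realType}.

Definition locally_compact_group :=
  hausdorff_space G /\ locally_compact [set: G].

Definition ltranslate (x : G) (A : set G) : set G := [set (x * a)%g | a in A].

(* The Haar measure as a nonzero left-invariant Radon measure on Borel sets. *)
Record left_haar (mu : {measure set G -> \bar R}) : Prop := LeftHaar {
  haar_neq0 : mu [set: G] != 0%E ;
  haar_translate : forall (x : G) (E : set G), measurable E ->
    mu (ltranslate x E) = mu E ;
  haar_compact : forall K : set G, compact K -> (mu K < +oo)%E ;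
  haar_outer : forall E : set G, measurable E ->
    mu E = ereal_inf [set mu U | U in [set U | open U /\ E `<=` U]] ;
  haar_inner : forall U : set G, open U ->
    mu U = ereal_sup [set mu K | K in [set K | compact K /\ K `<=` U]]
}.

Variable haar : {measure set G -> \bar R}.

(* Scalars are real: a mean on the complex space Linfty is determined by its
   restriction to real functions.
   Functions are kept as representatives: the elements of L1 and Linfty are
   functions, with a seminorm, rather than classes for equality a.e.  A
   functional that is bounded for this seminorm takes the same value on functions
   that are equal a.e., so that the duals are the same.
   For sigma-finite Haar measures (in particular if G is compact), Linfty
   modulo equality a.e. is the dual of L1. *)
Definition L1 := LfunType haar (lexx (1%E : \bar R)).
Definition Linfty := LfunType haar (leey (1%E : \bar R)).

Definition opnorm (m : Linfty -> R) : \bar R :=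
  ereal_sup [set `|m phi|%:E | phi in
    [set phi : Linfty | ('N[haar]_+oo[EFin \o phi] <= 1)%E]].

Definition Linfty_dual : set (Linfty -> R) :=
  [set m | scalar m /\ (opnorm m < +oo)%E].

Definition means : set (Linfty -> R) :=
  [set m | [/\ Linfty_dual m, opnorm m = 1%E &
    forall phi : Linfty, {ae haar, forall x, 0 <= phi x} -> 0 <= m phi]].

Definition M1 : set L1 :=
  [set f | ('N[haar]_1[EFin \o f] = 1)%E /\ {ae haar, forall x, 0 <= f x}].

Definition functional_of_L1 (f : G -> R) : Linfty -> R :=
  fun phi => \int[haar]_x (f x * phi x).

Definition left_shift (x : G) (phi : G -> R) : G -> R :=
  fun y => phi (x^-1 * y)%g.

Definition conv_fun (f phi : G -> R) : G -> R :=
  fun y => \int[haar]_x (f x * left_shift x phi y).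

(* Linfty is a subtype of G -> R: insubd 0 h is h if h is measurable and
   essentially bounded, and 0 otherwise.  The default value is never used in
   conv, because conv_fun f phi is continuous and bounded, nor in chi for a
   measurable set (chiE). *)
Definition conv (f : L1) (phi : Linfty) : Linfty :=
  insubd (0 : Linfty) (conv_fun f phi).

Definition chi (E : set G) : Linfty := insubd (0 : Linfty) (\1_E : G -> R).

Definition TLIM : set (Linfty -> R) :=
  [set m | means m /\
    forall (f : L1) (phi : Linfty), M1 f -> m phi = m (conv f phi)].

Definition mean_on (A : set G) : Linfty -> R :=
  functional_of_L1 (fun x => \1_A x / fine (haar A)).

Definition folner_sets (K : set G) (eps : R) : set (set G) :=
  [set A | [/\ compact A, (0 < haar A)%E &
    forall x, K x ->
      fine (haar (ltranslate x A `+` A)) / fine (haar A) < eps]].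

Definition finite_measurable_partition (P : set (set G)) :=
  [/\ finite_set P, (forall E, P E -> measurable E) & partition P id [set: G]].

Definition mean_nbhs (m : Linfty -> R) (P : set (set G)) (eps : R) :
    set (Linfty -> R) :=
  [set n | means n /\ forall E, P E -> `|m (chi E) - n (chi E)| < eps].

Definition TLIM0 : set (Linfty -> R) :=
  [set m | TLIM m /\
    forall (P : set (set G)) (K : set G) (eps : R),
      finite_measurable_partition P -> compact K -> 0 < eps < 1 ->
      exists2 A, folner_sets K eps A & mean_nbhs m P eps (mean_on A)].

Lemma chiE (E : set G) : measurable E -> chi E = \1_E :> (G -> R).
Proof.
move=> mE; rewrite /chi; apply: (@insubdK _ _ Linfty); rewrite inE/=.
apply/andP; split; rewrite inE/=; first exact: measurable_indic.
rewrite /finite_norm unlock; case: ifP => // _.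
apply: (@le_lt_trans _ _ 1%:E); last exact: ltry.
apply: ereal_inf_lbound => /=; apply: nearW => x /=.
by rewrite lee_fin indicE; case: (x \in E); rewrite ?normr1// normr0.
Qed.

End topological_left_invariant_means.

Arguments locally_compact_group {d} G.
Arguments Linfty_dual {d G R} haar _.
Arguments means {d G R} haar _.
Arguments M1 {d G R} haar _.
Arguments functional_of_L1 {d G R} haar f _.
Arguments chi {d G R} haar E.
Arguments TLIM {d G R} haar _.
Arguments mean_on {d G R} haar A _.
Arguments mean_nbhs {d G R} haar m P eps _.
Arguments TLIM0 {d G R} haar _.

(* Main.v *)
Require Import Defs.
From HB Require Import structures.
From mathcomp Require Import all_boot all_order all_algebra.
From mathcomp Require Import finmap.
From mathcomp Require Import lra.
From mathcomp Require Import all_classical all_reals all_analysis.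
From mathcomp Require Import measurable_realfun ess_sup_inf.

(** Let [vol] be the Haar measure of the compact group [G].

    Uniqueness.  Convolving with the constant density [vol^-1] turns [phi] into
    the function [y |-> vol^-1 * \int phi (x^-1 * y) dx].  If the Haar measure is
    invariant under inversion and right translations, this is the constant
    [vol^-1 * \int phi], so every [m] in [TLIM] satisfies
    [m phi = (vol^-1 * \int phi) * m 1]; and [m 1 = 1] because the norm of a
    positive functional is its value at [1].

    Existence.  One needs [\int (f * phi) = \int phi] for every probability
    density [f], that is, Tonelli's theorem for [f x * phi (x^-1 * y)].  For a
    compact group that is not second countable this function need not be
    measurable for the product of the Borel sigma-algebras, so product measures
    cannot be used.

    Both parts rest on the uniqueness of the invariant measure
    ([invariant_measure_unique]): a left invariant and a right invariant finite
    outer regular measure are proportional.  It is proved by cutting [G] into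
    finitely many small Borel pieces and comparing a compact set with an open set
    containing it, so that only finite sums are exchanged with integrals.
    Applied to the image of the Haar measure under inversion, it gives the
    inversion and right invariance ([haar_invg], [haar_right_invariant]).  Applied
    to [B |-> \int (1_A * 1_B)], which is a right invariant measure dominated by a
    multiple of the Haar measure, it gives Tonelli's theorem for indicators
    ([integral_conv_indic]); this extends to [f] and [phi] one factor at a time
    ([weighted_tonelli], [haar_conv_tonelli]).

    Finally [TLIM0] contains the mean over [G] because the Folner set [G] itself
    gives that mean exactly. *)

Set Implicit Arguments.
Unset Strict Implicit.
Unset Printing Implicit Defensive.

Import Order.TTheory GRing.Theory Num.Theory.
Import numFieldNormedType.Exports.

Local Open Scope classical_set_scope.
Local Open Scope ring_scope.

(** * Translations and Borel sets in a topological group *)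

Section topological_group.
Context {d : measure_display} {G : borelGroupType d}.
Implicit Types (x y : G) (A K U : set G).

Lemma lmulg_continuous x : continuous (fun y : G => (x * y)%g).
Proof.
move=> y; apply: (@continuous_comp G (G * G)%type G (fun z => (x, z))
  (fun p => (p.1 * p.2)%g)); last exact: mulg_continuous.
by apply: cvg_pair => //=; exact: cvg_cst.
Qed.

Lemma rmulg_continuous x : continuous (fun y : G => (y * x)%g).
Proof.
move=> y; apply: (@continuous_comp G (G * G)%type G (fun z => (z, x))
  (fun p => (p.1 * p.2)%g)); last exact: mulg_continuous.
by apply: cvg_pair => //=; exact: cvg_cst.
Qed.

Lemma open_borel U : open U -> measurable U.
Proof. by move=> oU; rewrite measurable_borel; exact: sub_sigma_algebra. Qed.

Lemma closed_borel A : closed A -> measurable A.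
Proof.
by move=> cA; rewrite -(setCK A); apply: measurableC; apply: open_borel;
  exact: closed_openC.
Qed.

Lemma continuous_borel (f : G -> G) : continuous f -> measurable_fun [set: G] f.
Proof.
move=> /continuousP cf; apply: (@measurability _ _ _ _ _ _ (@open G)).
  exact: measurable_borel.
by move=> _ [U oU <-]; rewrite setTI; apply: open_borel; exact: cf.
Qed.

Lemma measurable_lmulg x : measurable_fun [set: G] (fun y : G => (x * y)%g).
Proof. by apply: continuous_borel; exact: lmulg_continuous. Qed.

Lemma measurable_rmulg x : measurable_fun [set: G] (fun y : G => (y * x)%g).
Proof. by apply: continuous_borel; exact: rmulg_continuous. Qed.

Lemma measurable_invg : measurable_fun [set: G] (fun y : G => (y^-1)%g).
Proof. by apply: continuous_borel; exact: invg_continuous. Qed.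

Lemma measurable_preimage (f : G -> G) A :
  measurable_fun [set: G] f -> measurable A -> measurable (f @^-1` A).
Proof. by move=> mf mA; rewrite -[X in measurable X]setTI; exact: mf. Qed.

(** Continuity of the product at the points [(k, g)], made uniform in [k] by
    compactness.  It plays the part of the uniform continuity of continuous
    functions, so that measures can be compared on sets only. *)
Lemma compact_mulg_near K U g : compact K -> open U ->
  (forall k, K k -> U (k * g)%g) ->
  \forall v \near g, forall k, K k -> U (k * v)%g.
Proof.
move=> /compact_near_coveringP cK oU KU.
apply: (cK G (nbhs g) (fun v k => U (k * v)%g)) => k Kk /=.
have /(_ U) : continuous_at (k, g) (fun p : G * G => (p.1 * p.2)%g).
  exact: mulg_continuous.
by apply; apply: open_nbhs_nbhs; split => //; exact: KU.
Qed.

(** The pieces come from a finite cover of [G] by translates of [V^-1], each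
    translate being deprived of the previous ones: disjointness makes the measures
    of the pieces add up. *)
Lemma small_borel_partition (V : set G) :
    compact [set: G] -> open V -> V 1%g ->
  exists (n : nat) (E : nat -> set G) (c : nat -> G),
  [/\ forall i, measurable (E i), trivIset [set: nat] E,
      [set: G] = \big[setU/set0]_(i < n) E i &
      forall i y, (i < n)%N -> E i y -> V (y^-1 * c i)%g].
Proof.
move=> cG oV V1.
pose f (c : G) : set G := [set y | V (y^-1 * c)%g].
have of_ c : open (f c).
  move/continuousP : (@invg_continuous G) => /(_ _ _) ic.
  have := @rmulg_continuous c; move/continuousP => /(_ _ oV) /ic.
  by [].
move: cG; rewrite compact_cover => /(_ G setT f).
case=> [c _|y _|D' _ D'f]; first exact: of_.
  by exists y => //; rewrite /f /= mulVg.
pose c i := nth (1%g : G) (enum_fset D') i.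
pose F i := f (c i).
exists (size (enum_fset D')), (seqDU F), c; split => //.
- move=> i; apply: measurableD; first by apply: open_borel; exact: of_.
  by apply: bigsetU_measurable => j _; apply: open_borel; exact: of_.
- rewrite -bigsetU_seqDU; apply/seteqP; split=> // y _.
  have [z /= zD fzy] := D'f y Logic.I.
  rewrite -bigcup_mkord; exists (index z (enum_fset D')).
    by rewrite /= index_mem.
  by rewrite /F (_ : c _ = z) //; exact: nth_index.
- by move=> i y _ Ey; exact: (subset_seqDU Ey).
Qed.

End topological_group.

(** * Uniqueness of the invariant measure of a compact group *)

Section finite_measure.
Context {d : measure_display} {T : measurableType d} {R : realType}.
Variable mu : {measure set T -> \bar R}.
Hypothesis mu_fin : (mu [set: T] < +oo)%E.
Implicit Types A B : set T.

Lemma finite_measure_fin_num A : measurable A -> mu A \is a fin_num.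
Proof.
move=> mA; rewrite ge0_fin_numE//; apply: le_lt_trans mu_fin.
by apply: le_measure => //; rewrite inE.
Qed.

Lemma fine_measureC A : measurable A ->
  fine (mu (~` A)) = fine (mu [set: T]) - fine (mu A).
Proof.
move=> mA; rewrite -setTD measureD// setTI fineB//.
  exact: finite_measure_fin_num.
exact: finite_measure_fin_num.
Qed.

End finite_measure.

Section invariant_measures.
Context {d : measure_display} {G : borelGroupType d} {R : realType}.
Implicit Types (mu nu : {measure set G -> \bar R}) (E K U : set G).

Definition left_invariant mu := forall x E, measurable E ->
  mu ((fun y : G => (x * y)%g) @^-1` E) = mu E.

Definition right_invariant mu := forall x E, measurable E ->
  mu ((fun y : G => (y * x)%g) @^-1` E) = mu E.

Definition outer_regular mu := forall E (e : R), measurable E -> 0 < e ->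
  exists U, [/\ open U, E `<=` U & (mu U <= mu E + e%:E)%E].

(** Compare the two ways of integrating the indicator of [K] at [x * y].
    For fixed [x], integrating over [y] gives [mu K] by left invariance.
    Cut the range of [y] into pieces [E i] with centres [c i], so small that
    [x * y] in [K] forces [x * c i] in [U]; then [mu K] is at most the sum of the
    [mu (E i)] for which [x * c i] lies in [U], and integrating this bound over
    [x] gives [nu U] for each piece by right invariance. *)
Lemma invariant_compact_open_le mu nu K U :
    compact [set: G] -> left_invariant mu -> right_invariant nu ->
    compact K -> closed K -> open U -> K `<=` U ->
  (mu K * nu [set: G] <= mu [set: G] * nu U)%E.
Proof.
move=> cG linv rinv cK clK oU KU.
have mK : measurable K := closed_borel clK.
have mU : measurable U := open_borel oU.
have /nbhs_interior : \forall v \near (1 : G)%g, forall k, K k -> U (k * v)%g.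
  by apply: compact_mulg_near => // k /KU; rewrite mulg1.
rewrite nbhsE => -[V [oV V1] sV].
have [n [E [c [mE tE TE EV]]]] := small_borel_partition cG oV V1.
have mpre i : measurable ((fun x : G => (x * c i)%g) @^-1` U).
  by apply: measurable_preimage => //; exact: measurable_rmulg.
have le_sum x : (mu K <= \sum_(i < n)
    mu (E i) * (\1_((fun x : G => (x * c i)%g) @^-1` U) x)%:E)%E.
  have mxK : measurable ((fun y : G => (x * y)%g) @^-1` K).
    by apply: measurable_preimage => //; exact: measurable_lmulg.
  rewrite -(linv x K mK) -[X in mu X]setIT TE big_distrr/=.
  rewrite (@measure_bigsetU _ _ _ mu
    (fun i => (fun y : G => (x * y)%g) @^-1` K `&` E i)); last 2 first.
  - by move=> i; exact: measurableI.
  - apply/trivIsetP => i j _ _ ij.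
    move/trivIsetP : tE => /(_ _ _ Logic.I Logic.I ij) Eij.
    by rewrite setIACA Eij setI0.
  apply: lee_sum => i _; rewrite indicE; case: (boolP (x \in _)) => [_|].
    rewrite mule1; apply: le_measure => //; rewrite ?inE//; exact: measurableI.
  rewrite mule0 notin_setE => nU; rewrite (_ : _ `&` _ = set0) ?measure0//.
  apply/seteqP; split => // y [/= Kxy Ey]; apply: nU.
  (* x * c i = (x * y) * (y^-1 * c i) *)
  have /(_ _ (EV i y (ltn_ord i) Ey)) /interior_subset := sV.
  by move=> /(_ _ Kxy); rewrite -mulgA mulVKg.
have -> : (mu [set: G] * nu U = \sum_(i < n) mu (E i) * nu U)%E.
  by rewrite TE (@measure_bigsetU _ _ _ mu E)// ge0_sume_distrl.
rewrite -integral_cst//.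
apply: (@le_trans _ _ (\int[nu]_x \sum_(i < n)
    mu (E i) * (\1_((fun x : G => (x * c i)%g) @^-1` U) x)%:E)%E).
  apply: ge0_le_integral => //.
  apply: emeasurable_sum => i; apply: measurable_funeM.
  by apply/measurable_EFinP; exact: measurable_indic.
rewrite ge0_integral_sum//; last first.
  move=> i; apply: measurable_funeM.
  by apply/measurable_EFinP; exact: measurable_indic.
apply: lee_sum => i _; rewrite ge0_integralZl//; last first.
  by apply/measurable_EFinP; exact: measurable_indic.
by rewrite integral_indic// setIT rinv.
Qed.

(** [invariant_compact_open_le] compares compact sets with open sets; regularity
    extends this to [mu E * nu G <= mu G * nu E] for Borel sets, and
    the same inequality for the complement of [E] is the converse. *)
Lemma invariant_measure_unique mu nu :
    compact [set: G] ->
    (mu [set: G] < +oo)%E -> (nu [set: G] < +oo)%E ->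
    left_invariant mu -> right_invariant nu ->
    outer_regular mu -> outer_regular nu ->
  forall E, measurable E ->
  fine (mu E) * fine (nu [set: G]) = fine (mu [set: G]) * fine (nu E).
Proof.
move=> cG muT nuT linv rinv mureg nureg.
pose m A := fine (mu A); pose n A := fine (nu A).
have mfin A : measurable A -> mu A \is a fin_num by exact: finite_measure_fin_num.
have nfin A : measurable A -> nu A \is a fin_num by exact: finite_measure_fin_num.
have m_ge0 : 0 <= m setT by exact: fine_ge0.
have n_ge0 : 0 <= n setT by exact: fine_ge0.
have half E : measurable E -> m E * n setT <= m setT * n E.
  move=> mE; apply/ler_addgt0Pr => e e0.
  have s0 : 0 < m setT + n setT + 1 by lra.
  (* with [h] as regularity error on both sides, the total error is
     [h * (m G + n G)] *)
  pose h := e / (m setT + n setT + 1).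
  have h0 : 0 < h by exact: divr_gt0.
  have [U [oU EU]] := nureg E h mE h0.
  have mCE : measurable (~` E) by exact: measurableC.
  have [W [oW CEW]] := mureg (~` E) h mCE h0.
  have mU := open_borel oU; have mW := open_borel oW.
  rewrite -(fineK (mfin _ mW)) -(fineK (mfin _ mCE)) -EFinD lee_fin => hW.
  rewrite -(fineK (nfin _ mU)) -(fineK (nfin _ mE)) -EFinD lee_fin => hU.
  have clW : closed (~` W) by exact: open_closedC.
  have cW : compact (~` W) by exact: subclosed_compact clW cG _.
  have WU : ~` W `<=` U.
    by move=> x; apply: contra_notP => nUx; apply: CEW => /EU.
  have := invariant_compact_open_le cG linv rinv cW clW oU WU.
  have mCW : measurable (~` W) by exact: measurableC.
  rewrite -(fineK (mfin _ mCW)) -(fineK (nfin _ measurableT)).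
  rewrite -(fineK (mfin _ measurableT)) -(fineK (nfin _ mU)) -!EFinM lee_fin.
  move: hW hU; rewrite !fine_measureC// -/(m W) -/(m E) -/(m setT).
  rewrite -/(n U) -/(n E) -/(n setT) => hW hU hWU.
  have -> : e = h * (m setT + n setT + 1) by rewrite /h divfK// gt_eqF.
  have := ler_wpM2r n_ge0 hW; have := ler_wpM2l m_ge0 hU; lra.
move=> E mE; apply/eqP; rewrite eq_le half//=.
have := half _ (measurableC mE).
rewrite /m /n !fine_measureC//; nra.
Qed.

End invariant_measures.

(** * Inversion and right invariance of the Haar measure *)

Section invariant_integral.
Context {d : measure_display} {T : measurableType d} {R : realType}.
Variables (mu : {measure set T -> \bar R}) (f : T -> T).
Hypothesis mf : measurable_fun [set: T] f.

(** [pushforward mu f] bundled with its structure of measure, which depends on the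
    proof [mf]. *)
Definition image_measure : {measure set T -> \bar R}.
Proof. by refine (pushforward mu f : measure _ _); exact: mf. Defined.

Hypothesis mu_f : forall A, measurable A -> mu (f @^-1` A) = mu A.

Lemma ge0_integral_invariant (g : T -> \bar R) :
  measurable_fun [set: T] g -> (forall x, (0 <= g x)%E) ->
  (\int[mu]_x g (f x) = \int[mu]_x g x)%E.
Proof.
move=> mg g0; transitivity (\int[pushforward mu f]_x g x)%E.
  by rewrite ge0_integral_pushforward.
by apply: (eq_measure_integral mu (m1 := image_measure)) => A mA _; exact: mu_f.
Qed.

Lemma integral_invariant (g : T -> \bar R) : measurable_fun [set: T] g ->
  (\int[mu]_x g (f x) = \int[mu]_x g x)%E.
Proof.
move=> mg; rewrite integralE [RHS]integralE; congr (_ - _)%E.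
- rewrite -[RHS]ge0_integral_invariant//; last exact: measurable_funepos.
  by apply: eq_integral => x _; rewrite !funeposE.
- rewrite -[RHS]ge0_integral_invariant//; last exact: measurable_funeneg.
  by apply: eq_integral => x _; rewrite !funenegE.
Qed.

End invariant_integral.

Section haar_compact_group.
Context {d : measure_display} {G : borelGroupType d} {R : realType}.
Variable haar : {measure set G -> \bar R}.
Hypothesis cG : compact [set: G].
Hypothesis haarP : left_haar haar.
Implicit Types (A B E K U : set G) (x y : G).

Lemma haar_finite : (haar [set: G] < +oo)%E.
Proof. exact: (haar_compact haarP cG). Qed.

Let haar_fin E : measurable E -> haar E \is a fin_num.
Proof. exact: finite_measure_fin_num haar_finite _. Qed.

Lemma haar_gt0 : 0 < fine (haar [set: G]).
Proof.
by rewrite fine_gt0// haar_finite lt0e (haar_neq0 haarP) measure_ge0.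
Qed.

Lemma haar_left_invariant : left_invariant haar.
Proof.
move=> x E mE; rewrite -(haar_translate haarP x^-1%g mE); congr (haar _).
apply/seteqP; split => [y /= Exy|_ /= [y Ey <-]]; last by rewrite mulVKg.
by exists (x * y)%g => //; rewrite mulKg.
Qed.

Lemma haar_outer_regular : outer_regular haar.
Proof.
move=> E e mE e0.
have : ereal_inf [set haar U | U in [set U | open U /\ E `<=` U]] \is a fin_num.
  by rewrite -(haar_outer haarP mE); exact: haar_fin.
move=> /(lb_ereal_inf_adherent e0); rewrite -(haar_outer haarP mE).
by case=> _ [U [oU EU] <-] /ltW UE; exists U.
Qed.

(** In a compact group the complement of an open set containing [~` E] is a compact
    subset of [E]. *)
Lemma haar_inner_regular E (a : R) : measurable E -> (a%:E < haar E)%E ->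
  exists K, [/\ compact K, closed K, K `<=` E & (a%:E < haar K)%E].
Proof.
move=> mE; rewrite -(fineK (haar_fin mE)) lte_fin => aE.
have mCE := measurableC mE.
have e0 : 0 < (fine (haar E) - a) / 2 by lra.
have [U [oU CEU]] := haar_outer_regular mCE e0.
have mU := open_borel oU.
rewrite -(fineK (haar_fin mU)) -(fineK (haar_fin mCE)) -EFinD lee_fin.
rewrite (fine_measureC haar_finite mE) => hU.
have clU : closed (~` U) by exact: open_closedC.
exists (~` U); split => //.
- exact: subclosed_compact clU cG _.
- by move=> x; apply: contra_notP => nEx; exact: CEU.
- have mCU := measurableC mU.
  rewrite -(fineK (haar_fin mCU)) (fine_measureC haar_finite mU) lte_fin; lra.
Qed.

(** The image of the Haar measure under inversion is right invariant and has the
    same total mass, hence it is the Haar measure by uniqueness. *)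
Lemma haar_invg E : measurable E ->
  haar ((fun x : G => x^-1%g) @^-1` E) = haar E.
Proof.
move=> mE; pose nu := image_measure haar (@measurable_invg _ G).
have rinv : right_invariant nu.
  move=> x F mF; have mVF := measurable_preimage (@measurable_invg _ G) mF.
  rewrite -[RHS](haar_left_invariant x^-1%g mVF); congr (haar _).
  by apply/funext => y; rewrite /preimage /= invgM invgK.
have oreg : outer_regular nu.
  move=> F e mF e0; have mVF := measurable_preimage (@measurable_invg _ G) mF.
  have [U [oU FU UF]] := haar_outer_regular mVF e0.
  exists ((fun x : G => x^-1%g) @^-1` U); split.
  - by move/continuousP : (@invg_continuous G); exact.
  - by move=> x Fx; apply: FU; rewrite /= invgK.
  - rewrite (_ : nu _ = haar U)//; congr (haar _).
    by apply/funext => x; rewrite /preimage /= invgK.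
have := invariant_measure_unique (nu := nu) cG haar_finite haar_finite
  haar_left_invariant rinv haar_outer_regular oreg mE.
rewrite mulrC => /(mulfI (lt0r_neq0 haar_gt0)) hE.
have mVE := measurable_preimage (@measurable_invg _ G) mE.
by rewrite -(fineK (haar_fin mE)) hE fineK//; exact: haar_fin.
Qed.

(** Right translations are conjugate to left translations by inversion. *)
Lemma haar_right_invariant : right_invariant haar.
Proof.
move=> x E mE.
have mR := measurable_preimage (measurable_rmulg x) mE.
have mVE := measurable_preimage (@measurable_invg _ G) mE.
rewrite -(haar_invg mR) -[RHS](haar_invg mE).
rewrite -[RHS](haar_left_invariant x^-1%g mVE); congr (haar _).
by apply/funext => y; rewrite /preimage /= invgM invgK.
Qed.

Lemma measurable_invg_rmulg y : measurable_fun [set: G] (fun x : G => x^-1 * y)%g.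
Proof. exact: (measurableT_comp (measurable_rmulg y) (@measurable_invg _ G)). Qed.

Lemma haar_invg_rmulg y E : measurable E ->
  haar ((fun x : G => x^-1 * y)%g @^-1` E) = haar E.
Proof.
move=> mE; have mR := measurable_preimage (measurable_rmulg y) mE.
by rewrite -[RHS](haar_right_invariant y mE) -[RHS](haar_invg mR).
Qed.

End haar_compact_group.

(** * Exchange of integrals with a weight *)

Import HBNNSimple.

(** A nonnegative measurable function is an increasing limit of simple functions,
    and a simple function is a finite sum of multiples of indicators. *)
Lemma ge0_measurable_fun_ind {d : measure_display} {T : measurableType d}
    {R : realType} (P : (T -> \bar R) -> Prop) :
    (forall A (r : R), measurable A -> 0 <= r ->
      P (fun x => r%:E * (\1_A x)%:E)%E) ->
    (forall f g : T -> \bar R,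
      measurable_fun [set: T] f -> (forall x, (0 <= f x)%E) ->
      measurable_fun [set: T] g -> (forall x, (0 <= g x)%E) ->
      P f -> P g -> P (f \+ g)%E) ->
    (forall (f_ : (T -> \bar R)^nat) f,
      (forall n, measurable_fun [set: T] (f_ n)) ->
      (forall n x, (0 <= f_ n x)%E) ->
      (forall x, nondecreasing_seq (f_ ^~ x)) ->
      (forall x, f_ n x @[n --> \oo] --> f x) ->
      (forall n, P (f_ n)) -> P f) ->
  forall f, measurable_fun [set: T] f -> (forall x, (0 <= f x)%E) -> P f.
Proof.
move=> Pindic PD Plim f mf f0.
have [g [ndg gf]] := approximation measurableT mf (fun x _ => f0 x).
apply: (Plim (fun n x => (g n x)%:E)).
- by move=> n; apply/measurable_EFinP.
- by move=> n x; rewrite lee_fin.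
- by move=> x m n mn; rewrite lee_fin; exact/lefP/ndg.
- by move=> x; exact: gf.
move=> n; set h := g n.
pose F (r : R) (x : T) := (r%:E * (\1_(h @^-1` [set r]) x)%:E)%E.
have -> : (fun x => (h x)%:E) =
    (fun x => \sum_(r <- fset_set (range h)) F r x)%E.
  apply/funext => x; rewrite fimfunE fsbig_finite//= -sumEFin.
  by apply: eq_bigr => r _; rewrite EFinM.
have : forall r, r \in enum_fset (fset_set (range h)) -> 0 <= r.
  move=> r; change (r \in fset_set (range h) -> 0 <= r).
  by rewrite in_fset_set// inE => -[x _ <-].
pose Q (k : T -> \bar R) :=
  [/\ measurable_fun [set: T] k, forall x, (0 <= k x)%E & P k].
move=> hr; suff [] : Q (fun x => \sum_(r <- fset_set (range h)) F r x)%E by [].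
elim: (enum_fset _) hr => [_|r s IHs hr].
  under eq_fun do rewrite big_nil.
  split => //; rewrite (_ : (fun=> 0%E) = (fun x => 0%:E * (\1_set0 x)%:E)%E).
    exact: Pindic.
  by apply/funext => x; rewrite mul0e.
have r0 : 0 <= r by apply: hr; rewrite mem_head.
have mr : measurable (h @^-1` [set r]) by [].
have [|ms s0 Ps] := IHs; first by move=> t ts; apply: hr; rewrite in_cons ts orbT.
under eq_fun do rewrite big_cons.
have mF : measurable_fun [set: T] (F r).
  by apply: measurable_funeM; apply/measurable_EFinP; exact: measurable_indic.
have F0 x : (0 <= F r x)%E by rewrite mule_ge0// lee_fin.
split.
- exact: emeasurable_funD.
- by move=> x; rewrite adde_ge0.
- by apply: PD => //; exact: Pindic.
Qed.

Section weighted_tonelli.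
Context {d d' : measure_display} {X : measurableType d} {Y : measurableType d'}.
Context {R : realType}.
Variables (mu : {measure set X -> \bar R}) (nu : {measure set Y -> \bar R}).
Variables (w : X -> Y -> R) (c : \bar R).
Hypothesis mw : forall y, measurable_fun [set: X] (w ^~ y).
Hypothesis w0 : forall x y, 0 <= w x y.

Let wint (f : X -> \bar R) (y : Y) : \bar R := (\int[mu]_x (f x * (w x y)%:E))%E.

Hypothesis cfin : c \is a fin_num.
Hypothesis wint_indic : forall A, measurable A ->
  measurable_fun [set: Y] (wint (fun x => (\1_A x)%:E)) /\
  (\int[nu]_y wint (fun x => (\1_A x)%:E) y = mu A * c)%E.

(** The functions [f] for which the integrals can be exchanged are closed under
    sums and increasing limits.  The joint behaviour of [w] in its two arguments
    enters only through indicators, so that [wint_indic] can replace its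
    measurability for a product sigma-algebra. *)
Lemma weighted_tonelli (f : X -> \bar R) :
    measurable_fun [set: X] f -> (forall x, (0 <= f x)%E) ->
  measurable_fun [set: Y] (wint f) /\
  (\int[nu]_y wint f y = (\int[mu]_x f x) * c)%E.
Proof.
have mwE y : measurable_fun [set: X] (fun x => (w x y)%:E).
  by apply/measurable_EFinP; exact: mw.
have wE0 x y : (0 <= (w x y)%:E)%E by rewrite lee_fin.
have wint_ge0 g y : (forall x, (0 <= g x)%E) -> (0 <= wint g y)%E.
  by move=> g0; apply: integral_ge0 => x _; rewrite mule_ge0.
move: f; apply: ge0_measurable_fun_ind.
- move=> A r mA r0.
  have mI : measurable_fun [set: X] (fun x => (\1_A x)%:E : \bar R).
    by apply/measurable_EFinP; exact: measurable_indic.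
  have [mind intind] := wint_indic mA.
  have wintZ : wint (fun x => r%:E * (\1_A x)%:E)%E =
      (fun y => r%:E * wint (fun x => (\1_A x)%:E) y)%E.
    apply/funext => y; rewrite /wint; under eq_integral do rewrite -muleA.
    rewrite ge0_integralZl//.
    - exact: emeasurable_funM.
    - by move=> x _; rewrite mule_ge0// lee_fin.
  rewrite wintZ; split; first exact: measurable_funeM.
  rewrite ge0_integralZl//; last first.
    by move=> y _; apply: wint_ge0 => x; rewrite lee_fin.
  rewrite intind ge0_integralZl//.
  by rewrite integral_indic// setIT muleA.
- move=> f g mf f0 mg g0 [mWf Wf] [mWg Wg].
  have wintD : wint (f \+ g)%E = (wint f \+ wint g)%E.
    apply/funext => y; rewrite /wint.
    under eq_integral do rewrite ge0_muleDl//.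
    rewrite ge0_integralD//.
    - by move=> x _; rewrite mule_ge0.
    - exact: emeasurable_funM.
    - by move=> x _; rewrite mule_ge0.
    - exact: emeasurable_funM.
  rewrite wintD; split; first exact: emeasurable_funD.
  rewrite ge0_integralD//; last 2 first.
  - by move=> y _; exact: wint_ge0.
  - by move=> y _; exact: wint_ge0.
  by rewrite Wf Wg ge0_integralD// [RHS]ge0_muleDl//; apply: integral_ge0.
- move=> f_ f mf_ f_0 ndf f_f IH.
  have f0 x : (0 <= f x)%E.
    have /cvg_lim <- // := f_f x.
    by apply: lime_ge; [apply/cvg_ex; exists (f x); exact: f_f|exact: nearW].
  have mWn n : measurable_fun [set: Y] (wint (f_ n)) by have [] := IH n.
  have ndW y : nondecreasing_seq (fun n => wint (f_ n) y).
    move=> m n mn; apply: ge0_le_integral => //.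
    - by move=> x _; rewrite mule_ge0.
    - exact: emeasurable_funM.
    - exact: emeasurable_funM.
    - by move=> x _; rewrite lee_wpmul2r//; exact: ndf.
  have Wcvg y : wint (f_ n) y @[n --> \oo] --> wint f y.
    rewrite /wint [X in _ --> X](_ : _ =
        \int[mu]_x limn (fun n => f_ n x * (w x y)%:E))%E.
      apply: cvg_monotone_convergence => //.
      - by move=> n; exact: emeasurable_funM.
      - by move=> n x _; rewrite mule_ge0.
      - by move=> x _ m n mn; rewrite lee_wpmul2r//; exact: ndf.
    by apply: eq_integral => x _; apply/esym/cvg_lim => //; exact: cvgeZr.
  split; first exact: (emeasurable_fun_cvg (fun n => wint (f_ n))).
  have intcvg : (\int[nu]_y wint (f_ n) y)%E @[n --> \oo] -->
      (\int[nu]_y wint f y)%E.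
    rewrite [X in _ --> X](_ : _ = \int[nu]_y limn (fun n => wint (f_ n) y))%E.
      by apply: cvg_monotone_convergence => // n y _; exact: wint_ge0.
    by apply: eq_integral => y _; apply/esym/cvg_lim.
  have fcvg : (\int[mu]_x f_ n x)%E @[n --> \oo] --> (\int[mu]_x f x)%E.
    rewrite [X in _ --> X](_ : _ = \int[mu]_x limn (fun n => f_ n x))%E.
      by apply: cvg_monotone_convergence => // x _; exact: ndf.
    by apply: eq_integral => x _; apply/esym/cvg_lim.
  have := cvgeZr cfin fcvg.
  under eq_fun do rewrite -(proj2 (IH _)).
  by move=> /(cvg_unique _ intcvg) -> //.
Qed.

End weighted_tonelli.

(** * Tonelli's theorem for convolutions *)

Section haar_convolution.
Context {d : measure_display} {G : borelGroupType d} {R : realType}.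
Variable haar : {measure set G -> \bar R}.
Hypothesis cG : compact [set: G].
Hypothesis haarP : left_haar haar.
Implicit Types (A B E K U : set G) (x y : G).

Let haar_fin E : measurable E -> haar E \is a fin_num.
Proof. exact: (finite_measure_fin_num (haar_finite cG haarP)). Qed.

Let mpre y B : measurable B -> measurable ((fun x : G => x^-1 * y)%g @^-1` B).
Proof. by apply: measurable_preimage; exact: measurable_invg_rmulg. Qed.

(** This is [\int 1_A x * 1_B (x^-1 * y) dx], the convolution of two
    indicators. *)
Definition conv_indic A B y := haar (A `&` (fun x : G => x^-1 * y)%g @^-1` B).

Lemma conv_indic_bigcup A (F : (set G)^nat) y : measurable A ->
    (forall n, measurable (F n)) -> trivIset [set: nat] F ->
  conv_indic A (\bigcup_n F n) y = (\sum_(0 <= n <oo) conv_indic A (F n) y)%E.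
Proof.
move=> mA mF tF; rewrite /conv_indic preimage_bigcup setI_bigcupr.
rewrite measure_bigcup//; first by apply: eq_eseriesl => n; rewrite in_setT.
- by move=> n _; apply: measurableI => //; exact: mpre.
- apply/trivIsetP => i j _ _ ij.
  move/trivIsetP : tF => /(_ _ _ Logic.I Logic.I ij) Fij.
  by rewrite setIACA setIid -preimage_setI Fij preimage_set0 setI0.
Qed.

(** A compact subset of [A `&` y B^-1] of almost full measure remains in
    [A `&` v B^-1] for [v] near [y]. *)
Lemma conv_indic_open_lsc A B (a : R) : measurable A -> open B ->
  open [set y | (a%:E < conv_indic A B y)%E].
Proof.
move=> mA oB; have mB := open_borel oB.
rewrite openE => y /= ay.
have mAy := measurableI _ _ mA (mpre y mB).
have [K [cK clK KAy aK]] := haar_inner_regular cG haarP mAy ay.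
have cVK : compact [set (x^-1)%g | x in K].
  apply: continuous_compact cK; apply: continuous_subspaceT.
  exact: invg_continuous.
have : \forall v \near y, forall k, [set (x^-1)%g | x in K] k -> B (k * v)%g.
  by apply: compact_mulg_near => // _ [x /KAy [_ Bxy] <-].
rewrite /interior /=; apply: filterS => v Kv.
apply: (lt_le_trans aK); apply: le_measure; rewrite ?inE//.
- exact: closed_borel.
- by apply: measurableI => //; exact: mpre.
- move=> x Kx; have [Ax _] := KAy x Kx; split => //=.
  by apply: Kv; exists x.
Qed.

(** Lower semicontinuity settles open [B]; complements and disjoint unions yield
    all Borel sets. *)
Lemma measurable_conv_indic A B : measurable A -> measurable B ->
  measurable_fun [set: G] (conv_indic A B).
Proof.
move=> mA; rewrite [X in X _ -> _](@measurable_borel d G); move: B.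
apply: dynkin_induction.
- exact: measurable_borel.
- exact: openI.
- apply: (eq_measurable_fun (cst (haar A))) => [y _|]; last exact: measurable_cst.
  by rewrite /conv_indic preimage_setT setIT.
- move=> U oU; apply: (measurability _ (ErealGenOInfty.measurableE R)).
  move=> /= _ [_ [a ->]] <-; rewrite setTI preimage_itvoy.
  by apply: open_borel; exact: conv_indic_open_lsc.
- move=> B mB mcB.
  apply: (eq_measurable_fun (fun y => haar A - conv_indic A B y)%E) => [y _|].
    have mBy := mpre y mB.
    rewrite /conv_indic preimage_setC -setDE measureD//.
    by rewrite ltey_eq haar_fin.
  by apply: emeasurable_funB => //; exact: measurable_cst.
- move=> F mF tF mcF.
  apply: (eq_measurable_fun (fun y => \sum_(0 <= n <oo) conv_indic A (F n) y)%E).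
    by move=> y _; rewrite conv_indic_bigcup.
  exact: ge0_emeasurable_sum.
Qed.

(** As a function of [B] the left-hand side is a right invariant measure of total
    mass [haar A * haar G], at most [haar G] times the Haar measure and therefore
    outer regular: uniqueness identifies it. *)
Lemma integral_conv_indic A B : measurable A -> measurable B ->
  (\int[haar]_y conv_indic A B y = haar A * haar B)%E.
Proof.
move=> mA mB.
pose lam E : \bar R := (\int[haar]_y conv_indic A E y)%E.
have lam0 : lam set0 = 0%E.
  by apply: integral0_eq => y _; rewrite /conv_indic preimage_set0 setI0 measure0.
have lam_ge0 E : (0 <= lam E)%E by apply: integral_ge0.
have lam_sigma : semi_sigma_additive lam.
  move=> F mF tF mUF; rewrite [X in _ --> X](_ : _ =
      \int[haar]_y (\sum_(n <oo) conv_indic A (F n) y))%E; last first.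
    by apply: eq_integral => y _; exact: conv_indic_bigcup.
  rewrite integral_nneseries//; last by move=> n; exact: measurable_conv_indic.
  by apply: is_cvg_nneseries => n _ _; exact: integral_ge0.
pose lamM : {measure set G -> \bar R} :=
  HB.pack lam (isMeasure.Build _ _ _ lam lam0 lam_ge0 lam_sigma).
have lamT : lamM [set: G] = (haar A * haar [set: G])%E.
  rewrite -integral_cst//; apply: eq_integral => y _.
  by rewrite /conv_indic preimage_setT setIT.
have lam_le E : measurable E -> (lamM E <= haar E * haar [set: G])%E.
  move=> mE; rewrite -integral_cst//; apply: ge0_le_integral => //.
    exact: measurable_conv_indic.
  move=> y _; rewrite -(haar_invg_rmulg cG haarP y mE).
  by apply: le_measure; rewrite ?inE//; [apply: measurableI => //|]; exact: mpre.
have lam_fin : (lamM [set: G] < +oo)%E.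
  by rewrite lamT lte_mul_pinfty// ?haar_fin// (haar_finite cG haarP).
have rinv : right_invariant lamM.
  move=> x E mE; rewrite -[RHS](@ge0_integral_invariant _ _ _ haar _
    (measurable_rmulg x) (haar_right_invariant cG haarP x)) //.
  - apply: eq_integral => y _; congr (haar (_ `&` _)).
    by apply/funext => z; rewrite /preimage /= mulgA.
  - exact: measurable_conv_indic.
have oreg : outer_regular lamM.
  move=> E e mE e0.
  have e'0 : 0 < e / fine (haar [set: G]).
    by rewrite divr_gt0// (haar_gt0 cG haarP).
  have [U [oU EU UE]] := haar_outer_regular cG haarP mE e'0.
  exists U; split => //; have mU := open_borel oU.
  rewrite -(setDUK EU) measureU//; last 2 first.
  - exact: measurableD.
  - by rewrite setDE setICA setICr setI0.
  rewrite leeD2l//; apply: (le_trans (lam_le _ (measurableD mU mE))).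
  rewrite measureD// ?(setIidr EU); last first.
    by rewrite ltey_eq haar_fin.
  have -> : (haar U - haar E = (fine (haar U) - fine (haar E))%:E)%E.
    by rewrite EFinB !fineK ?haar_fin.
  rewrite -[haar setT]fineK ?haar_fin// -EFinM lee_fin.
  rewrite -ler_pdivlMr ?(haar_gt0 cG haarP)// lerBlDl -lee_fin EFinD.
  by rewrite !fineK ?haar_fin.
have := invariant_measure_unique cG (haar_finite cG haarP) lam_fin
  (haar_left_invariant haarP) rinv (haar_outer_regular cG haarP) oreg mB.
have lamB_fin := finite_measure_fin_num lam_fin mB.
rewrite lamT fineM ?haar_fin// mulrA [X in _ = X]mulrC => /(mulIf _) => hB.
rewrite -[LHS](fineK lamB_fin) -hB; last first.
  by rewrite gt_eqF// (haar_gt0 cG haarP).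
by rewrite mulrC EFinM !fineK// haar_fin.
Qed.

(** The two factors are approximated one at a time by [weighted_tonelli]: [f] with
    the weight [1_B (x^-1 * y)], then [phi] with the weight [f (y * z^-1)], which
    appears after the substitution [z = x^-1 * y]. *)
Lemma haar_conv_tonelli (f phi : G -> R) :
    measurable_fun [set: G] f -> (forall x, 0 <= f x) ->
    (\int[haar]_x (f x)%:E < +oo)%E ->
    measurable_fun [set: G] phi -> (forall x, 0 <= phi x) ->
  measurable_fun [set: G]
    (fun y => \int[haar]_x ((f x)%:E * (phi (x^-1 * y)%g)%:E))%E /\
  (\int[haar]_y \int[haar]_x ((f x)%:E * (phi (x^-1 * y)%g)%:E) =
    (\int[haar]_x (f x)%:E) * (\int[haar]_x (phi x)%:E))%E.
Proof.
move=> mf f0 ffin mphi phi0.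
have indic_case B : measurable B ->
  measurable_fun [set: G]
    (fun y => \int[haar]_x ((f x)%:E * (\1_B (x^-1 * y)%g)%:E))%E /\
  (\int[haar]_y \int[haar]_x ((f x)%:E * (\1_B (x^-1 * y)%g)%:E) =
    (\int[haar]_x (f x)%:E) * haar B)%E.
  move=> mB.
  apply: (weighted_tonelli (nu := haar) (w := fun x y => \1_B (x^-1 * y)%g)) => //.
  - move=> y; apply: (measurableT_comp _ (measurable_invg_rmulg y)).
    exact: measurable_indic.
  - exact: haar_fin.
  - move=> A mA; rewrite (_ : (fun y => _) = conv_indic A B).
      by split; [exact: measurable_conv_indic|exact: integral_conv_indic].
    apply/funext => y; rewrite /conv_indic -[in RHS](setIT (A `&` _)).
    rewrite -integral_indic//; last by apply: measurableI => //; exact: mpre.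
    apply: eq_integral => x _; rewrite -EFinM !indicE in_setI.
    by rewrite [RHS]/= -mulnb natrM.
  - by apply/measurable_EFinP.
have swap (g : G -> R) y : measurable_fun [set: G] g ->
    (\int[haar]_z ((g z)%:E * (f (y * z^-1)%g)%:E) =
     \int[haar]_x ((f x)%:E * (g (x^-1 * y)%g)%:E))%E.
  move=> mg; rewrite -(integral_invariant (measurable_invg_rmulg y)
    (haar_invg_rmulg cG haarP y)).
    by apply: eq_integral => x _; rewrite muleC invgM invgK mulVKg.
  apply: emeasurable_funM; first exact/measurable_EFinP.
  apply/measurable_EFinP; apply: (measurableT_comp mf).
  exact: (measurableT_comp (@measurable_lmulg _ G y) (@measurable_invg _ G)).
have [] := @weighted_tonelli _ _ _ _ _ haar haar (fun z y => f (y * z^-1)%g)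
  (\int[haar]_x (f x)%:E)%E _ _ _ _ (fun z => (phi z)%:E).
- move=> y; apply: (measurableT_comp mf).
  exact: (measurableT_comp (@measurable_lmulg _ G y) (@measurable_invg _ G)).
- by [].
- by rewrite ge0_fin_numE//; apply: integral_ge0 => x _; rewrite lee_fin.
- move=> B mB; have mI : measurable_fun [set: G] (\1_B : G -> R).
    exact: measurable_indic.
  have [mc ic] := indic_case B mB; split.
    by apply: (eq_measurable_fun _ _ mc) => y _; rewrite swap.
  by rewrite muleC -ic; apply: eq_integral => y _; exact: swap.
- exact/measurable_EFinP.
- by move=> x; rewrite lee_fin.
move=> mc ic; split.
  by apply: (eq_measurable_fun _ _ mc) => y _; rewrite swap.
by rewrite muleC -ic; apply: eq_integral => y _; rewrite swap.
Qed.

End haar_convolution.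

(** * Convolution of an integrable and a bounded function *)

Section convolution.
Context {d : measure_display} {G : borelGroupType d} {R : realType}.
Variable haar : {measure set G -> \bar R}.
Hypothesis cG : compact [set: G].
Hypothesis haarP : left_haar haar.

Let haarT_gt0 : (0 < haar [set: G])%E.
Proof. by rewrite lt0e (haar_neq0 haarP) measure_ge0. Qed.

Lemma ge0_integrable (g : G -> R) : measurable_fun [set: G] g ->
    (forall x, 0 <= g x) -> (\int[haar]_x (g x)%:E < +oo)%E ->
  haar.-integrable [set: G] (EFin \o g).
Proof.
move=> mg g0 gfin; apply/integrableP; split; first exact/measurable_EFinP.
by under eq_integral do rewrite gee0_abs ?lee_fin//.
Qed.

Lemma ae_invg_rmulg (P : G -> Prop) (y : G) :
  {ae haar, forall x, P x} -> {ae haar, forall x, P (x^-1 * y)%g}.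
Proof.
case=> N [mN N0 PN]; exists ((fun x : G => x^-1 * y)%g @^-1` N); split.
- by apply: measurable_preimage => //; exact: measurable_invg_rmulg.
- by rewrite (haar_invg_rmulg cG haarP).
- by move=> x /= nPx; exact: PN.
Qed.

Lemma Linfty_ae_bounded (phi : Linfty haar) :
  exists2 C : R, 0 <= C & {ae haar, forall x, `|phi x| <= C}.
Proof.
have : finite_norm haar +oo phi by exact: Lfunction_finite.
rewrite /finite_norm unlock haarT_gt0.
set s := ess_sup _ _ => sfin.
have s0 : (0 <= s)%E.
  by apply: ess_sup_gee => //; apply: nearW => x /=; rewrite lee_fin.
have sE : s = (fine s)%:E by rewrite fineK// ge0_fin_numE.
exists (fine s); first by rewrite fine_ge0.
have /ess_supP : (s <= (fine s)%:E)%E by rewrite -sE.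
by apply: filterS => x /=; rewrite lee_fin.
Qed.

Lemma bounded_Lfun (g : G -> R) (C : R) : measurable_fun [set: G] g ->
  (forall x, `|g x| <= C) -> g \in Lfun haar +oo%E.
Proof.
move=> mg gC; apply/andP; split; rewrite inE//=.
rewrite /finite_norm unlock haarT_gt0.
apply: (@le_lt_trans _ _ C%:E); last exact: ltry.
by apply/ess_supP; apply: nearW => x /=; rewrite lee_fin.
Qed.

(** Up to a null set [f] is nonnegative, and [phi] becomes so by adding an essential
    bound [C]; Tonelli's theorem applies to the resulting functions, and
    subtracting the constant again is harmless because the measure is finite. *)
Lemma conv_fun_spec (f : L1 haar) (phi : Linfty haar) : M1 haar f ->
  conv_fun haar f phi \in Lfun haar +oo%E /\
  (\int[haar]_y (conv_fun haar f phi y)%:E = \int[haar]_x (phi x)%:E)%E.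
Proof.
move=> [f1 f0].
have mf : measurable_fun [set: G] f by exact: measurable_funPT.
have mphi : measurable_fun [set: G] phi by exact: measurable_funPT.
pose g x := Num.max (f x) 0.
have mg : measurable_fun [set: G] g.
  by apply: measurable_maxr => //; exact: measurable_cst.
have g0 x : 0 <= g x by rewrite /g le_max lexx orbT.
have fg : {ae haar, forall x, f x = g x}.
  by apply: filterS f0 => x fx0; rewrite /g max_l.
have intg : (\int[haar]_x (g x)%:E = 1)%E.
  rewrite -f1 Lnorm1; apply: ge0_ae_eq_integral => //.
  - exact/measurable_EFinP.
  - by apply: measurableT_comp => //; exact/measurable_EFinP.
  - by move=> x _; rewrite lee_fin.
  - by apply: filterS fg => x fgx _ /=; rewrite fgx ger0_norm.
have [C C0 phiC] := Linfty_ae_bounded phi.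
(* [phi + C] truncated to its essential range, which makes all bounds hold
   everywhere instead of almost everywhere *)
pose psi x := Num.max 0 (Num.min (phi x + C) (2 * C)).
have mpsi : measurable_fun [set: G] psi.
  apply: measurable_maxr; first exact: measurable_cst.
  apply: measurable_minr; last exact: measurable_cst.
  by apply: measurable_funD => //; exact: measurable_cst.
have psi0 x : 0 <= psi x by rewrite /psi le_max lexx.
have psi2 x : psi x <= 2 * C.
  by rewrite /psi ge_max mulr_ge0//= ge_min lexx orbT.
have phipsi : {ae haar, forall x, phi x = psi x - C}.
  apply: filterS phiC => x; rewrite ler_norml => /andP[Cphi phiC].
  rewrite /psi min_l; last lra.
  by rewrite max_r; lra.
have [] := @haar_conv_tonelli _ _ _ haar cG haarP g psi mg g0 _ mpsi psi0.
  by rewrite intg ltry.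
set p := fun y : G => (\int[haar]_x ((g x)%:E * (psi (x^-1 * y)%g)%:E))%E.
rewrite -/(p _) intg mul1e => mp intp.
have mpsiy y : measurable_fun [set: G] (fun x : G => psi (x^-1 * y)%g).
  exact: (measurableT_comp mpsi (measurable_invg_rmulg y)).
have p0 y : (0 <= p y)%E.
  by apply: integral_ge0 => x _; rewrite mule_ge0// lee_fin.
have p2 y : (p y <= (2 * C)%:E)%E.
  apply: (@le_trans _ _ (\int[haar]_x ((2 * C)%:E * (g x)%:E))%E).
    apply: ge0_le_integral => //.
    - by move=> x _; rewrite mule_ge0// lee_fin.
    - by apply: emeasurable_funM; apply/measurable_EFinP.
    - by apply: emeasurable_funM; apply/measurable_EFinP.
    - by move=> x _; rewrite muleC lee_wpmul2r// lee_fin.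
  rewrite ge0_integralZl//; last 3 first.
  - exact/measurable_EFinP.
  - by move=> x _; rewrite lee_fin.
  - by rewrite lee_fin mulr_ge0.
  by rewrite intg mule1.
have pfin y : p y \is a fin_num.
  by rewrite ge0_fin_numE//; apply: le_lt_trans (p2 y) (ltry _).
have gint : haar.-integrable [set: G] (EFin \o g).
  by apply: ge0_integrable => //; rewrite intg ltry.
have gpsiint y : haar.-integrable [set: G] (fun x => (g x)%:E * (psi (x^-1 * y)%g)%:E)%E.
  apply: (@ge0_integrable (fun x => g x * psi (x^-1 * y)%g)).
  - exact: measurable_funM.
  - by move=> x; rewrite mulr_ge0.
  - by under eq_integral do rewrite EFinM; rewrite -/(p y) -ge0_fin_numE.
have convE y : conv_fun haar f phi y = fine (p y) - C.
  have -> : conv_fun haar f phi y = fine (\int[haar]_x (f x * phi (x^-1 * y)%g)%:E)%E by [].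
  rewrite (ae_eq_integral (fun x => (g x)%:E * (psi (x^-1 * y)%g)%:E
      - C%:E * (g x)%:E)%E) //; last 3 first.
  - apply/measurable_EFinP; apply: measurable_funM => //.
    exact: (measurableT_comp mphi (measurable_invg_rmulg y)).
  - apply: emeasurable_funB; apply: emeasurable_funM; exact/measurable_EFinP.
  - have := ae_invg_rmulg y phipsi; apply: filterS2 fg => x fgx -> _.
    by rewrite fgx -!EFinM -EFinB; congr EFin; lra.
  rewrite integralB//; last exact: integrableZl.
  rewrite integralZl// intg mule1 -/(p y) fineB//.
have mfp : measurable_fun [set: G] (fun y => fine (p y)).
  exact: (measurableT_comp _ mp).
have -> : conv_fun haar f phi = fun y => fine (p y) - C by apply/funext.
split.
  apply: (@bounded_Lfun _ C).
    by apply: measurable_funB => //; exact: measurable_cst.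
  move=> y; have := p0 y; have := p2 y.
  by rewrite -(fineK (pfin y)) !lee_fin /= => h1 h2; rewrite ler_norml; lra.
have psiint : haar.-integrable [set: G] (EFin \o psi).
  apply: ge0_integrable => //.
  apply: (@le_lt_trans _ _ (\int[haar]_x (2 * C)%:E)%E).
    apply: ge0_le_integral => //.
    - by move=> x _; rewrite lee_fin.
    - exact/measurable_EFinP.
    - by move=> x _; rewrite lee_fin.
  by rewrite integral_cst// lte_mul_pinfty// ?lee_fin ?mulr_ge0// (haar_finite cG haarP).
have Cint : haar.-integrable [set: G] (cst C%:E).
  apply: (@ge0_integrable (cst C)) => //.
  by rewrite (integral_cst haar measurableT C%:E) lte_mul_pinfty// ?lee_fin ?mulr_ge0// (haar_finite cG haarP).
rewrite [RHS](ae_eq_integral (fun x => (psi x)%:E - C%:E)%E)//; last 3 first.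
- exact/measurable_EFinP.
- by apply: emeasurable_funB => //; exact/measurable_EFinP.
- by apply: filterS phipsi => x -> _; rewrite EFinB.
rewrite [RHS]integralB// -intp -integralB//.
  by apply: eq_integral => y _; rewrite EFinB fineK.
apply/integrableP; split; first exact: mp.
rewrite (eq_integral p) => [|y _]; last by rewrite gee0_abs// p0.
by rewrite intp; have := integrable_fin_num measurableT psiint; rewrite ge0_fin_numE//;
  apply: integral_ge0 => x _; rewrite lee_fin.
Qed.

End convolution.

(** * The invariant mean of a compact group *)

Section means_compact_group.
Context {d : measure_display} {G : borelGroupType d} {R : realType}.
Variable haar : {measure set G -> \bar R}.
Hypothesis cG : compact [set: G].
Hypothesis haarP : left_haar haar.

Let haarT_gt0 : (0 < haar [set: G])%E.
Proof. by rewrite lt0e (haar_neq0 haarP) measure_ge0. Qed.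

Let vol := fine (haar [set: G]).

Let vol_gt0 : 0 < vol. Proof. exact: (haar_gt0 cG haarP). Qed.

Let haarTE : haar [set: G] = vol%:E.
Proof.
by rewrite /vol fineK//; exact: (finite_measure_fin_num (haar_finite cG haarP)).
Qed.

Let one := chi haar [set: G].

Let oneE x : one x = 1.
Proof. by rewrite /one chiE// indicT. Qed.

(** If [`|phi| <= 1] almost everywhere then [1 - phi] and [1 + phi] are nonnegative,
    so that [`|m phi| <= m 1]. *)
Lemma opnorm_positive (m : Linfty haar -> R) : scalar m ->
    (forall phi : Linfty haar, {ae haar, forall x, 0 <= phi x} -> 0 <= m phi) ->
  opnorm m = (m (chi haar [set: G]))%:E.
Proof.
move=> lin pos; rewrite -/one.
have m1 : 0 <= m one by apply: pos; apply: nearW => x; rewrite oneE.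
apply/eqP; rewrite eq_le; apply/andP; split.
- apply: ge_ereal_sup => _ [phi /= phi1 <-]; rewrite lee_fin.
  have {}phi1 : {ae haar, forall x, `|phi x| <= 1}.
    move: phi1; rewrite unlock haarT_gt0 => /ess_supP.
    by apply: filterS => x /=; rewrite lee_fin.
  have : 0 <= m ((-1) *: phi + one).
    apply: pos; apply: filterS phi1 => x.
    rewrite [X in _ -> _ <= X](_ : _ = -1 * phi x + one x)// oneE ler_norml; lra.
  have : 0 <= m (1 *: phi + one).
    apply: pos; apply: filterS phi1 => x.
    rewrite [X in _ -> _ <= X](_ : _ = 1 * phi x + one x)// oneE ler_norml; lra.
  by rewrite !lin ler_norml; lra.
- apply: ereal_sup_ubound; exists one => /=; last by rewrite ger0_norm.
  rewrite unlock haarT_gt0; apply/ess_supP; apply: nearW => x /=.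
  by rewrite oneE normr1.
Qed.

Lemma Linfty_integrable (phi : Linfty haar) :
  haar.-integrable [set: G] (EFin \o phi).
Proof.
apply/Lfun1_integrable; apply: (Lfun_subset (lexx _) (leey 1%E)).
- by rewrite haarTE.
- exact: leey.
- exact: LfunP.
Qed.

Lemma mean_onT (phi : Linfty haar) :
  mean_on haar [set: G] phi = vol^-1 * \int[haar]_x phi x.
Proof.
rewrite -RintegralZl//; last exact: Linfty_integrable.
by apply: eq_Rintegral => x _; rewrite indicT div1r.
Qed.

Lemma mean_onT_one : mean_on haar [set: G] (chi haar [set: G]) = 1.
Proof.
rewrite mean_onT.
have -> : \int[haar]_x chi haar [set: G] x = \int[haar]_x (cst 1) x.
  by apply: eq_Rintegral => x _; exact: oneE.
by rewrite Rintegral_cst// mul1r mulVf// gt_eqF.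
Qed.

Lemma mean_onT_means : means haar (mean_on haar [set: G]).
Proof.
have lin : scalar (mean_on haar [set: G]).
  move=> a phi psi; rewrite !mean_onT.
  rewrite (_ : \int[haar]_x _ = \int[haar]_x (a * phi x + psi x))//.
  rewrite RintegralD//; last 2 first.
  - by apply: (@integrableZl _ _ _ _ _ measurableT a) (Linfty_integrable phi).
  - exact: Linfty_integrable.
  rewrite (RintegralZl a measurableT (Linfty_integrable phi)) mulrDr.
  by congr (_ + _); exact: mulrCA.
have pos (phi : Linfty haar) : {ae haar, forall x, 0 <= phi x} ->
    0 <= mean_on haar [set: G] phi.
  move=> phi0; rewrite mean_onT; apply: mulr_ge0; first by rewrite invr_ge0 ltW.
  have mphi : measurable_fun [set: G] phi by exact: measurable_funPT.
  suff -> : \int[haar]_x phi x = \int[haar]_x Num.max (phi x) 0.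
    by apply: Rintegral_ge0 => x _; rewrite le_max lexx orbT.
  congr fine; apply: ae_eq_integral => //.
  - exact/measurable_EFinP.
  - by apply/measurable_EFinP; apply: measurable_maxr.
  - by apply: filterS phi0 => x phi0 _; rewrite max_l.
have op1 : opnorm (mean_on haar [set: G]) = 1%E.
  by rewrite opnorm_positive// mean_onT_one.
by split => //; split => //; rewrite op1 ltry.
Qed.

Lemma mean_onT_TLIM : TLIM haar (mean_on haar [set: G]).
Proof.
split; first exact: mean_onT_means.
move=> f phi Mf; have [convL convI] := conv_fun_spec cG haarP phi Mf.
rewrite !mean_onT; congr (_ * fine _); rewrite -convI.
by apply: eq_integral => x _; rewrite /Defs.conv insubdK.
Qed.

(** By inversion and right invariance, convolving with the constant density
    [vol^-1] turns every function into the constant given by its average. *)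
Lemma TLIM_mean_onT (m : Linfty haar -> R) : TLIM haar m ->
  m = mean_on haar [set: G].
Proof.
move=> [[[lin _] op1 pos] inv]; apply/funext => phi.
have cint : haar.-integrable [set: G] (EFin \o (cst vol^-1 : G -> R)).
  apply: (ge0_integrable (haar := haar)) => [|x|].
  - exact: measurable_cst.
  - by rewrite invr_ge0 ltW.
  - by rewrite (integral_cst haar measurableT (vol^-1)%:E) haarTE -EFinM ltry.
have cL : (cst vol^-1 : G -> R) \in Lfun haar 1%E by apply/Lfun1_integrable.
pose f0 : L1 haar := Lfun_Sub (lexx _) cL.
have Mf0 : M1 haar f0.
  split; last by apply: nearW => x; rewrite /= invr_ge0 ltW.
  rewrite Lnorm1 (eq_integral (cst (vol^-1)%:E)).
    by rewrite integral_cst// haarTE -EFinM mulVf// gt_eqF.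
  by move=> x _ /=; rewrite ger0_norm// invr_ge0 ltW.
have [convL _] := conv_fun_spec cG haarP phi Mf0.
have m1 : m one = 1 by apply: EFin_inj; rewrite -opnorm_positive.
have mphi : measurable_fun [set: G] phi by exact: measurable_funPT.
rewrite (inv f0 phi Mf0).
(* the summand [0] gives the right-hand side the shape [a *: u + v] in which
   [scalar] expresses linearity *)
have -> : Defs.conv f0 phi = mean_on haar [set: G] phi *: one + 0.
  apply/LfuneqP => y.
  rewrite [RHS](_ : _ = mean_on haar [set: G] phi * one y + 0)//.
  rewrite oneE mulr1 addr0 /Defs.conv insubdK// mean_onT.
  rewrite -RintegralZl//; last exact: Linfty_integrable.
  congr fine; apply: (integral_invariant (g := fun x => (vol^-1 * phi x)%:E)
    (measurable_invg_rmulg y) (haar_invg_rmulg cG haarP y)).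
  by apply/measurable_EFinP; apply: measurable_funM.
have m0 : m 0 = 0.
  by have := lin (-1) 0 0; rewrite scaler0 addr0; lra.
by rewrite lin m1 m0 mulr1 addr0.
Qed.

End means_compact_group.

Lemma kappa1_compact (G : topologicalType) : kappa_is [set: G] `I_1 ->
  compact [set: G].
Proof.
move=> [[F [cF coverF] F1] _].
have [g [gF ginj gsurj]] := card_set_bijP F1.
have [K FK gK] := gsurj 0%N (ltn0Sn 0).
suff -> : [set: G] = K by exact: cF.
apply/seteqP; split => // x /coverF[L FL Lx].
suff -> : K = L by [].
by apply: ginj; rewrite ?inE// gK; have := gF L FL; case: (g L).
Qed.

Theorem proposition3p2 (R : realType) (d : measure_display)
    (G : borelGroupType d) (haar : {measure set G -> \bar R}) :
  locally_compact_group G -> left_haar haar ->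
  kappa_is [set: G] `I_1 ->
  TLIM0 haar = TLIM haar /\ TLIM haar = [set mean_on haar [set: G]].
Proof.
move=> _ haarP /kappa1_compact cG.
have TLIM1 : TLIM haar = [set mean_on haar [set: G]].
  apply/seteqP; split => [m /(TLIM_mean_onT cG haarP) //|_ ->].
  exact: mean_onT_TLIM.
split => //; apply/seteqP; split => [m []//|m mT]; split => //.
move: mT; rewrite TLIM1 => -> P K eps _ _ /andP[eps0 _].
have shiftT x : ltranslate x [set: G] = [set: G].
  by apply/seteqP; split => // y _; exists (x^-1 * y)%g => //; rewrite mulVKg.
exists [set: G].
  split => //; first by rewrite lt0e (haar_neq0 haarP) measure_ge0.
  by move=> x _; rewrite shiftT setYK measure0 /= mul0r.
by split => [|E _]; [exact: mean_onT_means|rewrite subrr normr0].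
Qed.
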